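(* Let $F_{\underline{123}}(x,t,z)=\sum_{n\ge0}\sum_{\pi\in\mathbf I_n(3412)}x^n t^{\mathrm{occ}_{123}(\pi)}z^{\mathrm{fix}(\pi)}$. Then $$F_{\underline{123}}(x,t,z)=\frac{2A^2}{2(1-B)A^2-A^2+A^2C+A^2\sqrt{(1-C)^2-4A^2}},$$ where $A=x+\frac{x^3z^2(t-1)}{1-xz(t-1)-x^2z^2(t-1)}$, $B=xz+\frac{x^3z^3(t-1)}{1-xz(t-1)-x^2z^2(t-1)}$, and $C=xz+\frac{x^3z^2(t-1)(z+x(t-1)+x^2(t-1)z)}{1-xz(t-1)-x^2z^2(t-1)}+x^3(t-1)z$.
   Context: $\mathbf I_n(3412)$ is the set of involutions of $\{1,\dots,n\}$ with no subsequence order-isomorphic to $3412$. $\mathrm{occ}_{123}(\pi)$ is the number of indices $i$ such that $\pi_i\pi_{i+1}\pi_{i+2}$ is order-isomorphic to $123$ (occurrences of the consecutive pattern $\underline{123}$), and $\mathrm{fix}(\pi)$ is the number of fixed points. *)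

(* Defs.v *)
From HB Require Import structures.
From mathcomp Require Import all_boot all_order all_algebra all_fingroup.
From mathcomp Require Import boolp mpoly.

Set Implicit Arguments.
Unset Strict Implicit.
Unset Printing Implicit Defensive.

Import GRing.Theory.

Section Patterns.

Definition order_iso (w p : seq nat) : bool :=
  (size w == size p) &&
  [forall i : 'I_(size p), forall j : 'I_(size p),
     (nth 0 w i < nth 0 w j) == (nth 0 p i < nth 0 p j)].

Variable n : nat.
Implicit Type s : {perm 'I_n}.

(* One-line notation, with the values 0, ..., n-1 instead of 1, ..., n. *)
Definition one_line s : seq nat := [seq val (s i) | i <- enum 'I_n].

Definition is_involution s : bool := [forall i, s (s i) == i].

Definition contains (p : seq nat) s : bool :=
  [exists m : n.-tuple bool, order_iso (mask m (one_line s)) p].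

Definition avoids (p : seq nat) s : bool := ~~ contains p s.

Definition occ_consecutive (p : seq nat) s : nat :=
  #|[set i : 'I_n | order_iso (take (size p) (drop i (one_line s))) p]|.

Definition fix_count s : nat := #|[set i | s i == i]|.

Definition involutions_avoiding (p : seq nat) : {set {perm 'I_n}} :=
  [set s | is_involution s && avoids p s].

End Patterns.

Local Open Scope ring_scope.

Record fps (R : idomainType) := Fps { coefs : nat -> R }.
Add Printing Constructor fps.

HB.instance Definition _ (R : idomainType) := gen_eqMixin (fps R).
HB.instance Definition _ (R : idomainType) := gen_choiceMixin (fps R).

Section FpsRing.

Variable R : idomainType.
Implicit Types f g h : fps R.

Lemma fpsP f g : (forall n, coefs f n = coefs g n) -> f = g.
Proof. by case: f g => [f] [g] /= /funext ->. Qed.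

Definition fps_zero := Fps (fun=> 0 : R).
Definition fps_one := Fps (fun n => (n == 0)%:R : R).
Definition fps_opp f := Fps (fun n => - coefs f n).
Definition fps_add f g := Fps (fun n => coefs f n + coefs g n).
Definition fps_mul f g :=
  Fps (fun n => \sum_(i < n.+1) coefs f i * coefs g (n - i)).

Fact fps_addA : associative fps_add.
Proof. by move=> f g h; apply: fpsP => n /=; rewrite addrA. Qed.
Fact fps_addC : commutative fps_add.
Proof. by move=> f g; apply: fpsP => n /=; rewrite addrC. Qed.
Fact fps_add0 : left_id fps_zero fps_add.
Proof. by move=> f; apply: fpsP => n /=; rewrite add0r. Qed.
Fact fps_addN : left_inverse fps_zero fps_opp fps_add.
Proof. by move=> f; apply: fpsP => n /=; rewrite addNr. Qed.

HB.instance Definition _ :=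
  GRing.isZmodule.Build (fps R) fps_addA fps_addC fps_add0 fps_addN.

Definition fps_trunc m f : {poly R} := \poly_(i < m) coefs f i.

Lemma coefs_mul_trunc m n f g : (n < m)%N ->
  coefs (fps_mul f g) n = (fps_trunc m f * fps_trunc m g)`_n.
Proof.
move=> lt_nm; rewrite coefM /=; apply: eq_bigr => i _.
rewrite !coef_poly (leq_ltn_trans _ lt_nm) ?(leq_ltn_trans _ lt_nm) //.
  by rewrite leq_subr.
by rewrite -ltnS.
Qed.

Lemma coef_trunc_mul m n f g : (n < m)%N ->
  (fps_trunc m (fps_mul f g))`_n = (fps_trunc m f * fps_trunc m g)`_n.
Proof. by move=> lt_nm; rewrite coef_poly lt_nm (coefs_mul_trunc _ _ lt_nm). Qed.

Fact fps_mulA : associative fps_mul.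
Proof.
move=> f g h; apply: fpsP => n; rewrite !(@coefs_mul_trunc n.+1) //.
transitivity ((fps_trunc n.+1 f * (fps_trunc n.+1 g * fps_trunc n.+1 h))`_n).
  rewrite coefM [RHS]coefM; apply: eq_bigr => i _.
  by rewrite coef_trunc_mul // ltnS leq_subr.
rewrite mulrA coefM [RHS]coefM; apply: eq_bigr => i _.
by rewrite coef_trunc_mul.
Qed.

Fact fps_mulC : commutative fps_mul.
Proof.
by move=> f g; apply: fpsP => n; rewrite !(@coefs_mul_trunc n.+1) // mulrC.
Qed.

Fact fps_mul1 : left_id fps_one fps_mul.
Proof.
move=> f; apply: fpsP => n /=.
rewrite big_ord_recl mul1r subn0 big1 ?addr0 // => i _.
by rewrite mul0r.
Qed.

Fact fps_mulDl : left_distributive fps_mul fps_add.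
Proof.
move=> f g h; apply: fpsP => n /=; rewrite -big_split.
by apply: eq_bigr => i _; rewrite mulrDl.
Qed.

Fact fps_oner_neq0 : fps_one != 0.
Proof.
by apply/eqP => /(congr1 (fun f => coefs f 0)) /= /eqP; rewrite oner_eq0.
Qed.

HB.instance Definition _ := GRing.Zmodule_isComNzRing.Build (fps R)
  fps_mulA fps_mulC fps_mul1 fps_mulDl fps_oner_neq0.

Lemma coefs0 n : coefs (0 : fps R) n = 0. Proof. by []. Qed.
Lemma coefs1 n : coefs (1 : fps R) n = (n == 0)%:R. Proof. by []. Qed.
Lemma coefsD f g n : coefs (f + g) n = coefs f n + coefs g n.
Proof. by []. Qed.
Lemma coefsN f n : coefs (- f) n = - coefs f n. Proof. by []. Qed.
Lemma coefsM f g n :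
  coefs (f * g) n = \sum_(i < n.+1) coefs f i * coefs g (n - i).
Proof. by []. Qed.

(* Course-of-values recursion: coefficient n is [step] applied to the list of
   the coefficients 0, ..., n-1. *)
Fixpoint cov_prefix (step : seq R -> R) n : seq R :=
  if n is m.+1 then rcons (cov_prefix step m) (step (cov_prefix step m))
  else [::].

Definition cov_fps step := Fps (fun n => step (cov_prefix step n)).

Lemma size_cov_prefix step n : size (cov_prefix step n) = n.
Proof. by elim: n => //= n IHn; rewrite size_rcons IHn. Qed.

Lemma nth_cov_prefix step n i : (i < n)%N ->
  (cov_prefix step n)`_i = coefs (cov_fps step) i.
Proof.
elim: n => //= n IHn; rewrite ltnS leq_eqVlt nth_rcons size_cov_prefix.
by case: eqP => [-> _|_ /= lt_in]; rewrite ?ltnn ?lt_in ?IHn.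
Qed.

Definition fps_unit : pred (fps R) := fun f => coefs f 0 \is a GRing.unit.

Definition fps_inv_step f (s : seq R) : R :=
  if size s is 0 then (coefs f 0)^-1
  else - (coefs f 0)^-1 * \sum_(i < size s) coefs f (size s - i) * s`_i.

Definition fps_inv f := if fps_unit f then cov_fps (fps_inv_step f) else f.

Fact fps_mulVr : {in fps_unit, left_inverse 1 fps_inv *%R}.
Proof.
move=> f Uf; rewrite /fps_inv [fps_unit f]Uf; set g := cov_fps _.
have g0 : coefs g 0 = (coefs f 0)^-1 by [].
have gS n : coefs g n.+1 =
    - (coefs f 0)^-1 * \sum_(i < n.+1) coefs f (n.+1 - i) * coefs g i.
  rewrite {1}/g [LHS]/= -/(cov_prefix _ n.+1) {1}/fps_inv_step.
  rewrite size_cov_prefix; congr (_ * _); apply: eq_bigr => i _.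
  by rewrite nth_cov_prefix.
move: g g0 gS => g g0 gS.
apply: fpsP => -[|n]; rewrite coefsM coefs1.
  by rewrite big_ord1 subn0 g0 mulVr.
rewrite big_ord_recr /= subnn gS mulrAC mulNr mulVr // mulN1r.
by apply/eqP; rewrite subr_eq0; apply/eqP; apply: eq_bigr => i _; rewrite mulrC.
Qed.

Fact fps_unitP f g : g * f = 1 -> fps_unit f.
Proof.
move/(congr1 (fun f => coefs f 0)); rewrite coefsM big_ord1 subn0 => gf.
by apply/unitrPr; exists (coefs g 0); rewrite mulrC.
Qed.

Fact fps_inv_out : {in [predC fps_unit], fps_inv =1 id}.
Proof. by move=> f; rewrite inE /= /fps_inv => /negbTE Uf; rewrite [fps_unit f]Uf. Qed.

HB.instance Definition _ := GRing.ComNzRing_hasMulInverse.Build (fps R)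
  fps_mulVr fps_unitP fps_inv_out.

Lemma fps_neq0_ord f : f != 0 ->
  exists2 m, coefs f m != 0 & forall i, (i < m)%N -> coefs f i = 0.
Proof.
move=> nz_f; have ex : exists m, coefs f m != 0.
  apply: contrapT => H; case/negP: nz_f; apply/eqP/fpsP => n.
  by apply: contrapT => /eqP nz; apply: H; exists n.
case: (ex_minnP ex) => m nz_m min_m; exists m => // i lt_im.
by apply/eqP; apply: contraLR lt_im => /min_m; rewrite -leqNgt.
Qed.

Fact fps_integral f g : f * g = 0 -> (f == 0) || (g == 0).
Proof.
move=> fg0; apply/negPn/negP; rewrite negb_or => /andP[].
move=> /fps_neq0_ord[m nz_m lt_m] /fps_neq0_ord[k nz_k lt_k].
have := congr1 (fun h => coefs h (m + k)) fg0.
have lt_m_mk : (m < (m + k).+1)%N by rewrite ltnS leq_addr.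
rewrite coefsM coefs0 (bigD1 (Ordinal lt_m_mk)) //= addKn big1 ?addr0.
  by move/eqP; rewrite mulf_eq0 (negbTE nz_m) (negbTE nz_k).
move=> i /eqP ne_i; case: (ltngtP i m) => [lt_im | lt_mi | eq_im].
- by rewrite lt_m ?mul0r.
- rewrite (lt_k (m + k - i)%N) ?mulr0 //.
  by rewrite ltn_subLR ?ltn_add2r // -ltnS ltn_ord.
- by case: ne_i; apply: val_inj.
Qed.

HB.instance Definition _ :=
  GRing.ComUnitRing_isIntegral.Build (fps R) fps_integral.

Definition fpsC (c : R) : fps R := Fps (fun n => if n == 0%N then c else 0).
Definition fpsX : fps R := Fps (fun n => (n == 1)%:R).

(* The square root with constant term 1 of a series with constant term 1, when
   2 is invertible in R; see [fps_sqrtK] and [fps_sqrt_uniq]. *)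
Definition fps_sqrt_step f (s : seq R) : R :=
  if size s is 0 then 1
  else (coefs f (size s) - \sum_(1 <= i < size s) s`_i * s`_(size s - i)) / 2.

Definition fps_sqrt f : fps R := cov_fps (fps_sqrt_step f).

Lemma fps_sqrt0 f : coefs (fps_sqrt f) 0 = 1. Proof. by []. Qed.

Lemma coefs_sqrS g n : coefs g 0 = 1 ->
  coefs (g ^+ 2) n.+1 =
    coefs g n.+1 * 2 + \sum_(1 <= i < n.+1) coefs g i * coefs g (n.+1 - i).
Proof.
move=> g0; rewrite expr2 coefsM -(big_mkord xpredT
  (fun i => coefs g i * coefs g (n.+1 - i))).
rewrite big_nat_recl // big_nat_recr //= subn0 subnn g0 mul1r mulr1.
rewrite big_add1 /= addrCA -mulr2n mulr_natr addrC.
by congr (_ + _); rewrite mulr2n.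
Qed.

Lemma fps_sqrtK f : (2 : R) \is a GRing.unit -> coefs f 0 = 1 ->
  fps_sqrt f ^+ 2 = f.
Proof.
move=> U2 f0; apply: fpsP => -[|n].
  by rewrite expr2 coefsM big_ord1 f0 mulr1.
rewrite coefs_sqrS //.
have -> : coefs (fps_sqrt f) n.+1 = (coefs f n.+1 - \sum_(1 <= i < n.+1)
    coefs (fps_sqrt f) i * coefs (fps_sqrt f) (n.+1 - i)) / 2.
  rewrite {1}/fps_sqrt [LHS]/= -/(cov_prefix _ n.+1) {1}/fps_sqrt_step.
  rewrite size_cov_prefix; congr ((_ - _) / _).
  rewrite big_nat [RHS]big_nat; apply: eq_bigr => i /andP[i_gt0 lt_in].
  by rewrite !nth_cov_prefix // ltn_subrL i_gt0.
by rewrite divrK // subrK.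
Qed.

Lemma fps_sqrt_uniq f g : (2 : R) \is a GRing.unit ->
  coefs g 0 = 1 -> g ^+ 2 = f -> g = fps_sqrt f.
Proof.
move=> U2 g0 gf; have f0 : coefs f 0 = 1.
  by rewrite -gf expr2 coefsM big_ord1 g0 mulr1.
have : g ^+ 2 == fps_sqrt f ^+ 2 by rewrite gf fps_sqrtK.
rewrite eqf_sqr => /orP[/eqP -> // | /eqP gN].
have /eqP : 1 = - 1 :> R by rewrite -{1}g0 gN.
by rewrite -addr_eq0 => /eqP E; move: U2; rewrite mulr2n E unitr0.
Qed.

End FpsRing.

(* Q[t, z]; the generating function is a power series in x over this ring. *)
Definition coefRing : idomainType := {mpoly rat[2]}.
Definition tvar : coefRing := 'X_(ord0 : 'I_2).
Definition zvar : coefRing := 'X_(ord_max : 'I_2).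

Definition F123 : fps coefRing :=
  Fps (fun n => \sum_(s in involutions_avoiding n [:: 3; 4; 1; 2]%N)
     tvar ^+ occ_consecutive [:: 1; 2; 3]%N s * zvar ^+ fix_count s).

(* Main.v *)
(* An involution avoids 3412 iff no two of its 2-cycles [i < s i], [j < s j]
   cross, so it is encoded by a Motzkin word: up step, level step or down step
   at [i] according to whether [s i] is greater than, equal to or less than [i].
   An occurrence of 123 is then a level step preceded by a level or down step
   and followed by a level or up step.  Reading words from left to right, let
   [F], [G1], [G2] be the generating functions where the given past is,
   respectively, the start or an up step; a non-up step; a level step preceded
   by a non-up step.  Splitting off a leading level step or the first return of
   a leading up step gives
     F  = 1 + x z G1 + x^2 F G1,
     G1 = 1 + x z G2 + x^2 F G1,
     G2 = 1 + t (x z G2 + x^2 F G1),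
   and eliminating G1 and G2 leaves a quadratic equation for F. *)
Require Import Defs.
From mathcomp Require Import all_boot all_order all_algebra all_fingroup.
From mathcomp Require Import mpoly zify ring.
Set Implicit Arguments.
Unset Strict Implicit.
Unset Printing Implicit Defensive.
Import GRing.Theory.

(** * Noncrossing involutions as lists, and their two constructors *)

(** Plain lists let involutions of all lengths share one type. The second clause needs no bounds:
    beyond the end [nth] gives 0, which makes it vacuous in [i] and trivial in [j]. *)
Definition ncinv (l : seq nat) : Prop :=
  (forall i, i < size l -> nth 0 l i < size l /\ nth 0 l (nth 0 l i) = i) /\
  (forall i j, i < j < nth 0 l i -> nth 0 l j <= nth 0 l i).

(** As Motzkin words, [point a] is a level step followed by [a], and [arc a b] is up, [a], down,
    [b]. *)
Definition point (a : seq nat) : seq nat := 0 :: map S a.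
Definition arc (a b : seq nat) : seq nat :=
  (size a).+1 :: map S a ++ 0 :: map (addn (size a).+2) b.

Lemma size_point a : size (point a) = (size a).+1.
Proof. by rewrite /= size_map. Qed.

Lemma size_arc a b : size (arc a b) = (size a + size b).+2.
Proof. by rewrite /= size_cat /= !size_map addnS. Qed.

Lemma nth_point a i :
  nth 0 (point a) i = if 0 < i <= size a then (nth 0 a i.-1).+1 else 0.
Proof.
case: i => [|i] //=; case: ltnP => lt_ia; first by rewrite (nth_map 0).
by rewrite nth_default ?size_map.
Qed.

Lemma nth_arc a b i :
  nth 0 (arc a b) i =
    if i == 0 then (size a).+1
    else if i <= size a then (nth 0 a i.-1).+1
    else if (size a).+1 < i < (size a + size b).+2
      then (size a).+2 + nth 0 b (i - (size a).+2)
    else 0.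
Proof.
case: i => [|i] //=; rewrite nth_cat size_map.
case: ltnP => [lt_ia|le_ai]; first by rewrite (nth_map 0).
case Di: (i - size a) => [|k] /=; first by rewrite ifF //; lia.
have -> : i.+1 - (size a).+2 = k by lia.
case: (ltnP k (size b)) => lt_kb; first last.
  by rewrite nth_default ?size_map // ifF //; lia.
by rewrite (nth_map 0) // ifT //; lia.
Qed.

Lemma ncinv_point a : ncinv a -> ncinv (point a).
Proof.
case=> inv_a nc_a; split=> [i|i j].
  rewrite size_point !nth_point => lt_i; case: ifP => [i_a|]; last by split=> //=; lia.
  have [|lt_ai Ea] := inv_a i.-1; first by lia.
  by rewrite /= lt_ai Ea; split; lia.
rewrite !nth_point; case: ifP => i_a; case: ifP => j_a //; last by lia.
by have := nc_a i.-1 j.-1; lia.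
Qed.

Lemma ncinv_arc a b : ncinv a -> ncinv b -> ncinv (arc a b).
Proof.
move=> [inv_a nc_a] [inv_b nc_b]; split=> [i|i j].
  rewrite size_arc => lt_i; have := nth_arc a b i.
  case: ifP => [/eqP-> -> |i_gt0].
    by rewrite nth_arc !ltnn /=; split; lia.
  case: ifP => [le_ia ->|lt_ai].
    have [|lt Ea] := inv_a i.-1; first by lia.
    by rewrite nth_arc /= lt Ea; split; lia.
  case: ifP => [i_b ->|? ->]; last by rewrite nth_arc /=; split; lia.
  have [|lt Eb] := inv_b (i - (size a).+2); first by lia.
  rewrite nth_arc ifF; last by lia.
  rewrite ifT; last by lia.
  by rewrite addKn Eb; split; lia.
have a_le k : k < size a -> nth 0 a k < size a by move/inv_a=> [].
have := nc_a i.-1 j.-1; have := nc_b (i - (size a).+2) (j - (size a).+2).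
have := a_le i.-1; have := a_le j.-1.
by rewrite !nth_arc; do !case: ifP; lia.
Qed.

(** * Cutting out stable windows; the first-return decomposition *)

Definition block o m (l : seq nat) : seq nat := [seq v - o | v <- take m (drop o l)].

Lemma size_block o m l : o + m <= size l -> size (block o m l) = m.
Proof. by move=> le_l; rewrite size_map size_takel // size_drop; lia. Qed.

Lemma nth_block o m l i : o + m <= size l -> i < m ->
  nth 0 (block o m l) i = nth 0 l (o + i) - o.
Proof.
move=> le_l lt_im; rewrite (nth_map 0) ?size_takel ?size_drop; try lia.
by rewrite nth_take // nth_drop.
Qed.

Definition stable o m l := forall i, o <= i < o + m -> o <= nth 0 l i < o + m.

Lemma ncinv_block o m l :
  ncinv l -> o + m <= size l -> stable o m l -> ncinv (block o m l).
Proof.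
move=> [inv_l nc_l] le_l st_l; split=> [i|i j].
  rewrite size_block // => lt_im.
  have /andP[ge_o lt_o] : o <= nth 0 l (o + i) < o + m by apply: st_l; lia.
  have [|_ El] := inv_l (o + i); first by lia.
  rewrite nth_block // nth_block //; last by lia.
  by rewrite subnKC // El; split; lia.
have [le_mi|lt_im] := leqP m i.
  by rewrite (nth_default _ (_ : size _ <= i)) ?size_block //; lia.
have [le_mj|lt_jm] := leqP m j.
  by rewrite (nth_default _ (_ : size _ <= j)) ?size_block //; lia.
rewrite !nth_block //; have := nc_l (o + i) (o + j).
by have := st_l (o + i); have := st_l (o + j); lia.
Qed.

Lemma map_addn_block o m l : o + m <= size l -> stable o m l ->
  map (addn o) (block o m l) = take m (drop o l).
Proof.
move=> le_l st_l; apply: (@eq_from_nth _ 0) => [|i].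
  by rewrite !size_map.
rewrite size_map size_block // => lt_im.
rewrite (nth_map 0) ?size_block // nth_block // nth_take // nth_drop subnKC //.
by have := st_l (o + i); lia.
Qed.

(** If 0 is fixed, the remaining positions form a stable window. Otherwise 0 is paired with some
    [k.+1], and the positions strictly under this arc and those after it form two stable windows,
    giving [a] and [b]. *)
Lemma ncinv_cons v l : ncinv (v :: l) ->
  (exists2 a, ncinv a & v :: l = point a) \/
  (exists a b, [/\ ncinv a, ncinv b & v :: l = arc a b]).
Proof.
move=> nc; have [inv_l nc_l] := nc.
case: v => [|k] in nc inv_l nc_l *; [left|right].
  have st_l : stable 1 (size l) (0 :: l).
    move=> i Hi; have [|lt Ei] := inv_l i; first by rewrite /=; lia.
    by move: lt Ei => /=; case: (nth _ _ _) => [|w] //=; lia.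
  exists (block 1 (size l) (0 :: l)); first exact: ncinv_block.
  congr (_ :: _); rewrite -[map S _]/(map (addn 1) _) map_addn_block //=.
  by rewrite drop0 take_size.
set n := (size l).+1; set L := k.+1 :: l in nc inv_l nc_l *.
have szL : size L = n by [].
have L0 : nth 0 L 0 = k.+1 by [].
have [|lt_k Lk] := inv_l 0; first by [].
rewrite L0 szL in lt_k Lk.
have ne0 i : i < n -> i != k.+1 -> nth 0 L i != 0.
  by move=> lt_i; apply: contraNneq => E; have [//|_] := inv_l i; rewrite E L0 => ->.
have neS i : i < n -> 0 < i -> nth 0 L i != k.+1.
  by move=> lt_i; rewrite lt0n; apply: contraNneq => E; have [//|_] := inv_l i; rewrite E Lk => <-.
(* Noncrossing with the arc from 0 bounds these values by [k.+1]; the values 0 and [k.+1] are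
   already taken at the ends of that arc. *)
have st1 : stable 1 k L.
  move=> i Hi; have := ne0 i; have := neS i; have := nc_l 0 i; rewrite L0; lia.
(* A value in the first window would be sent back into it by [st1], contradicting involutivity. *)
have st2 : stable k.+2 (n - k.+2) L.
  move=> i Hi; have := ne0 i; have := neS i; have := st1 (nth 0 L i).
  by have [|] := inv_l i; rewrite ?szL; lia.
exists (block 1 k L), (block k.+2 (n - k.+2) L).
rewrite /arc size_block ?szL; last by lia.
split; [by apply: ncinv_block; rewrite ?szL //; lia| |].
  by apply: ncinv_block; rewrite ?szL //; lia.
rewrite map_addn_block ?szL //; last by lia.
rewrite -[map S _]/(map (addn 1) _) map_addn_block ?szL //; last by lia.
rewrite [take (n - _) _]take_oversize ?size_drop //.
have -> : 0 :: drop k.+2 L = drop k.+1 L by rewrite [RHS](drop_nth 0) ?szL // Lk.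
by rewrite /L /= drop0 cat_take_drop.
Qed.

Lemma point_inj : injective point.
Proof. by move=> a b [/(inj_map succn_inj)]. Qed.

(** The head records the length of the inner list, hence where to cut. *)
Lemma arc_inj a b c d : arc a b = arc c d -> a = c /\ b = d.
Proof.
case=> sz_ac /eqP; rewrite eqseq_cat ?size_map // => /andP[/eqP Eac].
move/eqP=> [Ebd]; split; first exact: (inj_map succn_inj).
by move: Ebd; rewrite sz_ac => /(inj_map (@addnI _)).
Qed.

(** * From permutations avoiding 3412 to noncrossing lists *)

Lemma size_one_line n (s : {perm 'I_n}) : size (one_line s) = n.
Proof. by rewrite size_map size_enum_ord. Qed.

Lemma nth_one_line n (s : {perm 'I_n}) (i : 'I_n) : nth 0 (one_line s) i = s i.
Proof. by rewrite (nth_map i) ?size_enum_ord // nth_ord_enum. Qed.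

Lemma one_line_inj n : injective (@one_line n).
Proof.
move=> s u E; apply/permP => i; apply: val_inj => /=.
by rewrite -!nth_one_line E.
Qed.

Lemma order_isoP (w p : seq nat) :
  reflect (size w = size p /\ forall i j, i < size p -> j < size p ->
             (nth 0 w i < nth 0 w j) = (nth 0 p i < nth 0 p j))
          (order_iso w p).
Proof.
apply: (iffP andP) => [[/eqP-> /forallP iso]|[-> iso]]; split=> //.
  move=> i j lt_i lt_j.
  by have /forallP/(_ (Ordinal lt_j))/eqP := iso (Ordinal lt_i).
by apply/forallP => i; apply/forallP => j; apply/eqP/iso.
Qed.

Lemma mask_nthP (m : bitseq) (l : seq nat) : size m = size l ->
  exists2 r, mask m l = map (nth 0 l) r & subseq r (iota 0 (size l)).
Proof.
move=> sz_m; exists (mask m (iota 0 (size l))).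
  by rewrite map_mask map_nth_iota0 // take_size.
exact: mask_subseq.
Qed.

Lemma subseq_iota r n : sorted ltn r -> all (fun i => i < n) r ->
  subseq r (iota 0 n).
Proof.
move=> r_lt /allP r_n; rewrite -(_ : [seq i <- iota 0 n | i \in r] = r).
  exact: filter_subseq.
apply: (irr_sorted_eq ltn_trans ltnn) => // [|i].
  exact/sorted_filter/iota_ltn_sorted/ltn_trans.
by rewrite mem_filter mem_iota add0n andb_idr // => /r_n.
Qed.

(** Trades bit masks for increasing lists of positions, which can be written out for a pattern of
    length four. *)
Lemma containsP n (p : seq nat) (s : {perm 'I_n}) :
  reflect (exists r, [/\ sorted ltn r, all (fun i => i < n) r
                       & order_iso (map (nth 0 (one_line s)) r) p])
          (contains p s).
Proof.
apply: (iffP existsP) => [[m]|[r [r_lt r_n iso]]].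
  have [|r -> sub_r] := @mask_nthP m (one_line s).
    by rewrite size_tuple size_one_line.
  rewrite size_one_line in sub_r; exists r; split=> //.
    exact: (subseq_sorted ltn_trans sub_r (iota_ltn_sorted _ _)).
  by apply/allP => i /(mem_subseq sub_r); rewrite mem_iota.
have /subseqP[m sz_m Er] := subseq_iota r_lt r_n.
rewrite size_iota in sz_m; exists (tcast sz_m (in_tuple m)).
rewrite val_tcast /= (_ : mask m _ = map (nth 0 (one_line s)) r) //.
by rewrite Er map_mask map_nth_iota0 ?size_one_line // take_oversize ?size_one_line.
Qed.

(* Two crossing arcs [i < j < l_i < l_j] are a 3412 at the positions
   [i, j, l_i, l_j].  Conversely, if [l_c < l_d < l_a < l_b] with
   [a < b < c < d], then the arcs of [a, b] cross when [c <= l_a], and those of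
   [c, d] cross otherwise. *)
Lemma mem_involutions_avoiding n (s : {perm 'I_n}) :
  s \in involutions_avoiding n [:: 3; 4; 1; 2] <-> ncinv (one_line s).
Proof.
set l := one_line s; have sz_l : size l = n by exact: size_one_line.
have El (i : 'I_n) : nth 0 l i = s i by exact: nth_one_line.
rewrite inE; split=> [/andP[/forallP s_inv /containsP s_av]|[inv_l nc_l]].
  have inv_l i : i < size l -> nth 0 l i < size l /\ nth 0 l (nth 0 l i) = i.
    rewrite sz_l => lt_i; rewrite (El (Ordinal lt_i)) El.
    by rewrite (eqP (s_inv (Ordinal lt_i))).
  split=> // i j /andP[lt_ij lt_ji]; rewrite leqNgt; apply/negP => lt_l.
  have lt_i : i < size l.
    by rewrite ltnNge; apply/negP => le_i; rewrite nth_default in lt_ji.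
  have lt_j : j < size l.
    by rewrite ltnNge; apply/negP => le_j; rewrite [nth 0 l j]nth_default in lt_l.
  have [lt_li li] := inv_l i lt_i; have [lt_lj lj] := inv_l j lt_j.
  case: s_av; exists [:: i; j; nth 0 l i; nth 0 l j]; split.
  - by rewrite /= lt_ij lt_ji lt_l.
  - by rewrite /= -sz_l lt_i lt_j lt_li lt_lj.
  rewrite -/l /= li lj; apply/order_isoP; split=> //.
  by move=> [|[|[|[|u]]]] [|[|[|[|v]]]] //= _ _; rewrite ?ltnn //; lia.
apply/andP; split.
  apply/forallP => i; apply/eqP/val_inj; rewrite /= -!El.
  by have [|//] := inv_l i; rewrite sz_l.
apply/containsP => -[r [r_lt r_n /order_isoP[]]]; rewrite size_map.
case: r r_lt r_n => [|a [|b [|c [|d [|? ?]]]]] //=.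
rewrite -/l -sz_l => /and4P[lt_ab lt_bc lt_cd _] /and5P[lt_a lt_b lt_c lt_d _] _ iso.
have := (iso 2 3 isT isT, iso 3 0 isT isT, iso 0 1 isT isT); rewrite /=.
case=> -[lt_1 lt_2] lt_3.
have [le_c|lt_ac] := leqP c (nth 0 l a).
  by have := nc_l a b; lia.
have [_ Ec] := inv_l c lt_c; have [_ Ed] := inv_l d lt_d.
by have := nc_l (nth 0 l c) (nth 0 l d); lia.
Qed.

(** * Enumeration by length and its recursion *)

Definition nclists n : seq (seq nat) :=
  [seq one_line s | s <- enum (involutions_avoiding n [:: 3; 4; 1; 2])].

Lemma nclists_uniq n : uniq (nclists n).
Proof. by rewrite map_inj_uniq ?enum_uniq //; apply: one_line_inj. Qed.

Lemma mem_nclists n l : l \in nclists n <-> size l = n /\ ncinv l.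
Proof.
split=> [/mapP[s]|[sz_l nc_l]].
  by rewrite mem_enum => /mem_involutions_avoiding nc_s ->; rewrite size_one_line.
have [inv_l _] := nc_l.
(* The default of [insubd] is never reached, since the entries of [l] are below [n]; [f] is its own
   inverse, hence a permutation. *)
pose f (i : 'I_n) : 'I_n := insubd i (nth 0 l i).
have fE i : val (f i) = nth 0 l i.
  by rewrite val_insubd; case: (inv_l i) => [|]; rewrite sz_l // => ->.
have f_inj : injective f.
  apply: (can_inj (g := f)) => i; apply: val_inj; rewrite !fE.
  by case: (inv_l i) => [|_ ->]; rewrite ?sz_l.
have El : one_line (perm f_inj) = l.
  apply: (@eq_from_nth _ 0) => [|i]; rewrite size_one_line // => lt_i.
  by rewrite (nth_one_line _ (Ordinal lt_i)) permE fE.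
apply/mapP; exists (perm f_inj) => //; rewrite mem_enum.
by apply/mem_involutions_avoiding; rewrite El.
Qed.

(** These lists have length [m.+1]; [i] is the length under the first arc. For [m = 0] the range of
    [i] is empty, so the truncated [m.-1] does no harm. *)
Definition arcs m : seq (seq nat) :=
  [seq arc ab.1 ab.2 | i <- iota 0 m,
     ab <- [seq (a, b) | a <- nclists i, b <- nclists (m.-1 - i)]].

Lemma arcsP m l :
  reflect (exists a b, [/\ ncinv a, ncinv b, (size a + size b).+1 = m & l = arc a b])
          (l \in arcs m).
Proof.
apply: (iffP allpairsPdep) => [[i [[a b] /= [i_m /allpairsP[[a' b'] /= [a_i b_i E]] ->]]]|].
  case: E a_i b_i => <- <- /mem_nclists[sz_a nc_a] /mem_nclists[sz_b nc_b].
  rewrite mem_iota in i_m; exists a, b; split=> //.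
  by rewrite sz_a sz_b; case: m i_m {sz_b} => //= m le_im; rewrite subnKC.
case=> a [b [nc_a nc_b sz ->]]; exists (size a), (a, b); split=> //.
  by rewrite mem_iota; lia.
apply/allpairsP; exists (a, b); split=> //; apply/mem_nclists; split=> //=.
by lia.
Qed.

Lemma arcs_uniq m : uniq (arcs m).
Proof.
apply: allpairs_uniq_dep => [|i _|]; first exact: iota_uniq.
  apply: allpairs_uniq; try exact: nclists_uniq.
  by move=> [a b] [c d].
move=> /= u v /allpairsPdep[i [[a b] [_ ab_i ->]]] /allpairsPdep[j [[c d] [_ cd_j ->]]] /=.
move=> /arc_inj[Eac Ebd]; rewrite -{}Eac -{}Ebd in cd_j *.
have szi k : (a, b) \in [seq (a, b) | a <- nclists k, b <- nclists (m.-1 - k)] -> size a = k.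
  by case/allpairsP=> -[a' b'] /= [/mem_nclists[sz_a _] _ [-> _]].
by rewrite -(szi i ab_i) (szi j cd_j).
Qed.

(** Both sides are duplicate-free (a zero or positive head separates the two kinds), so [ncinv_cons]
    and its converses suffice. This form splits sums over [nclists]. *)
Lemma nclistsS m : perm_eq (nclists m.+1) (map point (nclists m) ++ arcs m).
Proof.
apply: uniq_perm; first exact: nclists_uniq.
  rewrite cat_uniq map_inj_uniq ?nclists_uniq ?arcs_uniq //; last exact: point_inj.
  rewrite andbT; apply/hasPn => l /arcsP[a [b [_ _ _ ->]]].
  by apply/negP => /mapP[].
move=> l; rewrite mem_cat; apply/idP/orP => [/mem_nclists[sz_l nc_l]|].
  case: l => [|v l] // in sz_l nc_l *; case: (ncinv_cons nc_l) => [[a nc_a E]|].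
    left; rewrite E in sz_l *; apply/map_f/mem_nclists; split=> //.
    by move: sz_l; rewrite size_point => -[].
  case=> a [b [nc_a nc_b E]]; right; apply/arcsP; exists a, b; split=> //.
  by move: sz_l; rewrite E size_arc => -[].
case=> [/mapP[a /mem_nclists[sz_a nc_a] ->]|/arcsP[a [b [nc_a nc_b sz ->]]]].
  by apply/mem_nclists; rewrite size_point sz_a; split=> //; apply: ncinv_point.
by apply/mem_nclists; rewrite size_arc; split; [rewrite sz|apply: ncinv_arc].
Qed.

Lemma nclists0 : nclists 0 = [:: [::]].
Proof.
have : perm_eq (nclists 0) [:: [::]].
  apply: uniq_perm => // [|l]; first exact: nclists_uniq.
  rewrite inE; apply/idP/eqP => [/mem_nclists[/size0nil]//|->].
  by apply/mem_nclists; split=> //; split=> // i j; rewrite nth_nil andbF.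
by move/perm_small_eq; apply.
Qed.

(* In a noncrossing involution, position [i] starts an ascent iff it does not
   open an arc and position [i.+1] does not close one. *)
Lemma ncinv_ascent l i : ncinv l -> i.+1 < size l ->
  (nth 0 l i < nth 0 l i.+1) = (nth 0 l i <= i) && (i < nth 0 l i.+1).
Proof.
move=> [inv_l nc_l] lt_i; have [|lt1 E1] := inv_l i; first by lia.
have [|lt2 E2] := inv_l i.+1; first by lia.
have := nc_l i i.+1; have := nc_l (nth 0 l i) (nth 0 l i.+1).
rewrite E1 E2 => nc1 nc2; apply/idP/andP => [lt_l|[]]; last by lia.
have le_i : nth 0 l i <= i.
  rewrite leqNgt; apply/negP => gt_i; have [E|] := eqVneq (nth 0 l i) i.+1.
    by rewrite E in E1; lia.
  by lia.
split=> //; rewrite ltnNge; apply/negP => le_Si.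
have [E|] := eqVneq (nth 0 l i.+1) i; last by lia.
by rewrite E in E2; lia.
Qed.

(** * Both statistics computed along the list *)

(** Here [p] is the letter just before [l], and [h] tells whether [p] ends an ascent. *)
Fixpoint occ_after (h : bool) (p : nat) (l : seq nat) : nat :=
  if l is v :: l' then (h && (p < v)) + occ_after (p < v) v l' else 0.

Fixpoint fix_from (o : nat) (l : seq nat) : nat :=
  if l is v :: l' then (v == o) + fix_from o.+1 l' else 0.

Lemma order_iso123 (l : seq nat) :
  order_iso (take 3 l) [:: 1; 2; 3] =
    if l is a :: b :: c :: _ then a < b < c else false.
Proof.
case: l => [|a [|b [|c l]]] //; rewrite [take 3 _]/= take0.
apply/order_isoP/andP => [[_ iso]|[lt_ab lt_bc]].
  by have := (iso 0 1 isT isT, iso 1 2 isT isT) => -[/= -> ->].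
by split=> // -[|[|[|i]]] [|[|[|j]]] //= _ _; rewrite ?ltnn //; lia.
Qed.

Lemma occ_afterE p l :
  \sum_(0 <= i < (size l).+1) order_iso (take 3 (drop i (p :: l))) [:: 1; 2; 3] =
    occ_after false p l.
Proof.
elim: l p => [|v l IHl] p; first by rewrite big_nat1 drop0 order_iso123.
rewrite big_nat_recl // IHl drop0 order_iso123 /=.
by case: l {IHl}.
Qed.

Lemma fix_fromE o l :
  \sum_(0 <= i < size l) (nth 0 l i == o + i) = fix_from o l.
Proof.
elim: l o => [|v l IHl] o; first by rewrite big_geq.
rewrite big_nat_recl // addn0 /= -IHl; congr (_ + _).
by apply: eq_bigr => i _; rewrite addnS addSn.
Qed.

Lemma fix_count_one_line n (s : {perm 'I_n}) :
  fix_count s = fix_from 0 (one_line s).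
Proof.
rewrite -fix_fromE size_one_line big_mkord /fix_count -sum1_card big_mkcond /=.
by apply: eq_bigr => i _; rewrite inE nth_one_line add0n -val_eqE /=; case: eqP.
Qed.

Lemma occ_consecutive_one_line n (s : {perm 'I_n}) :
  occ_consecutive [:: 1; 2; 3] s =
    if one_line s is p :: l then occ_after false p l else 0.
Proof.
have : occ_consecutive [:: 1; 2; 3] s = \sum_(0 <= i < size (one_line s))
    order_iso (take 3 (drop i (one_line s))) [:: 1; 2; 3].
  rewrite size_one_line big_mkord /occ_consecutive -sum1_card big_mkcond /=.
  by apply: eq_bigr => i _; rewrite inE; case: order_iso.
by move->; case: (one_line s) => [|p l]; [rewrite big_geq|rewrite occ_afterE].
Qed.

Local Open Scope ring_scope.

(** * A multiplicative weight and its recursion *)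

Section Weight.

Variables (R : comNzRingType) (t z : R).

(* [o] is the position of the head of the list.  The flag [g] says that the
   previous letter of the Motzkin word is not an up step, and [h] that it is
   moreover a level step preceded by a non-up step. *)
Fixpoint weight (g h : bool) (o : nat) (l : seq nat) : R :=
  if l is v :: l' then
    (if h && (o <= v)%N then t else 1) * (if v == o then z else 1)
      * weight (v <= o)%N (g && (v == o)) o.+1 l'
  else 1.

Lemma weight_shift k g h o l :
  weight g h (k + o)%N (map (addn k) l) = weight g h o l.
Proof.
elim: l g h o => //= v l IHl g h o.
by rewrite leq_add2l eqn_add2l -addnS IHl leq_add2l.
Qed.

(** The letter [v] is a down step: it contributes the factor 1 and sets the flags to [true] and
    [false] whatever precedes it, so the weight factors there. *)
Lemma weight_cat_down g h o a v b : (v < o + size a)%N ->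
  weight g h o (a ++ v :: b) = weight g h o a * weight true false (o + size a).+1 b.
Proof.
elim: a g h o => [|u a IHa] g h o /=; rewrite ?addn0 => lt_v.
  rewrite leqNgt lt_v andbF (ltn_eqF lt_v) (ltnW lt_v) andbF !mul1r.
  by [].
by rewrite IHa ?addSnnS // mulrA.
Qed.

Lemma weight_point g h a :
  weight g h 0 (point a) = (if h then t else 1) * z * weight true g 0 a.
Proof. by rewrite /point /= !andbT -[map S a]/(map (addn 1) a) (weight_shift 1 _ _ 0). Qed.

Lemma weight_arc g h a b :
  weight g h 0 (arc a b) =
    (if h then t else 1) * (weight false false 0 a * weight true false 0 b).
Proof.
rewrite /arc /= andbT andbF mulr1 weight_cat_down ?size_map //.
rewrite -[map S a]/(map (addn 1) a) (weight_shift 1 _ _ 0).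
by rewrite -{1}[(1 + size a).+1]addn0 weight_shift.
Qed.

(** The letter [p] stands at position [o], and [hh] tells whether it ends an ascent. The hypothesis
    is the criterion of [ncinv_ascent], in a form inherited by tails. *)
Lemma weight_occ_after hh p l o :
  (forall i, (i < size l)%N -> (nth 0 (p :: l) i < nth 0 l i)%N =
     (nth 0 (p :: l) i <= o + i)%N && (o + i < nth 0 l i)%N) ->
  weight (p <= o)%N (hh && (p <= o)%N) o.+1 l =
    t ^+ occ_after hh p l * z ^+ fix_from o.+1 l.
Proof.
elim: l hh p o => [|v l IHl] hh p o asc /=; first by rewrite mulr1.
have := asc 0%N isT; rewrite /= addn0 => asc0.
(* Puts the new flag in the shape of the induction hypothesis, with [p < v] as the new [hh]. *)
have -> : (p <= o)%N && (v == o.+1) = (p < v)%N && (v <= o.+1)%N.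
  by rewrite asc0; lia.
rewrite IHl => [|i lt_i]; last by have := asc i.+1 lt_i; rewrite addnS addSn.
rewrite -andbA -asc0 !exprD.
by case: (hh && _); case: eqP => _; rewrite /= ?expr1 ?expr0; ring.
Qed.

Lemma weight_one_line n (s : {perm 'I_n}) :
  s \in involutions_avoiding n [:: 3; 4; 1; 2]%N ->
  weight false false 0 (one_line s) =
    t ^+ occ_consecutive [:: 1; 2; 3]%N s * z ^+ fix_count s.
Proof.
move/mem_involutions_avoiding; rewrite occ_consecutive_one_line fix_count_one_line.
case: (one_line s) => [|v l] nc; first by rewrite mulr1.
rewrite /= -[X in weight _ X]/(false && (v <= 0)%N) weight_occ_after => [|i lt_i].
  by rewrite exprD; case: eqP => _; rewrite /= ?expr1 ?expr0; ring.
by rewrite -[nth 0%N l i]/(nth 0%N (v :: l) i.+1) ncinv_ascent.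
Qed.

Definition total g h n : R := \sum_(l <- nclists n) weight g h 0 l.

Lemma total0 g h : total g h 0 = 1.
Proof. by rewrite /total nclists0 big_seq1. Qed.

Lemma totalS g h m :
  total g h m.+1 = (if h then t else 1) * (z * total true g m
    + \sum_(i < m) total false false i * total true false (m.-1 - i)).
Proof.
rewrite /total (perm_big _ (nclistsS m)) big_cat /= big_map mulrDr mulrA.
congr (_ + _).
  by rewrite mulr_sumr; apply: eq_bigr => a _; rewrite weight_point.
rewrite big_allpairs_dep -/(index_iota 0 m) -[m in iota 0 m]subn0 big_mkord mulr_sumr.
apply: eq_bigr => i _; rewrite big_allpairs mulr_suml mulr_sumr.
apply: eq_bigr => a _; rewrite !mulr_sumr.
by apply: eq_bigr => b _; rewrite weight_arc.
Qed.

End Weight.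

(** * The system of equations for the generating functions *)

Lemma coefsXM (R : idomainType) (f : fps R) n :
  coefs (fpsX R * f) n = if n is m.+1 then coefs f m else 0.
Proof.
rewrite coefsM; case: n => [|m]; first by rewrite big_ord1 mul0r.
rewrite big_ord_recl mul0r add0r big_ord_recl /= mul1r subSS subn0 big1 ?addr0 //.
by move=> i _; rewrite mul0r.
Qed.

Lemma coefsCM (R : idomainType) (c : R) (f : fps R) n :
  coefs (fpsC c * f) n = c * coefs f n.
Proof.
by rewrite coefsM big_ord_recl subn0 big1 ?addr0 // => i _; rewrite mul0r.
Qed.

Section GeneratingFunction.

Variables (R : idomainType) (t z : R).

(** [gf false false], [gf true false] and [gf true true] are the series F, G1 and G2. *)
Definition gf g h : fps R := Fps (total t z g h).

Lemma gf_eq g h :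
  gf g h = 1 + (if h then fpsC t else 1) * (fpsX R * fpsC z * gf true g
    + fpsX R ^+ 2 * (gf false false * gf true false)).
Proof.
rewrite expr2 -!mulrA; apply: fpsP => n; rewrite coefsD coefs1.
have scale (f : fps R) :
    coefs ((if h then fpsC t else 1) * f) n = (if h then t else 1) * coefs f n.
  by case: h; rewrite ?coefsCM ?mul1r.
rewrite scale coefsD !coefsXM; case: n {scale} => [|m].
  by rewrite addr0 mulr0 addr0; exact: total0.
rewrite add0r coefsCM [LHS]totalS coefsXM; congr (_ * (_ + _)).
by case: m => [|m]; [rewrite big_ord0|rewrite coefsM].
Qed.

End GeneratingFunction.

(** * Elimination and the discriminant *)

Lemma quadratic_of_system (K : comNzRingType) (x y t F G1 G2 : K) :
  F = 1 + y * G1 + x ^+ 2 * (F * G1) ->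
  G1 = 1 + y * G2 + x ^+ 2 * (F * G1) ->
  G2 = 1 + t * (y * G2 + x ^+ 2 * (F * G1)) ->
  x ^+ 2 * F ^+ 2 =
    (1 - t * y + x ^+ 2 * y * (t - 1)) * F - (1 - y * (t - 1) - y ^+ 2 * (t - 1)).
Proof.
move=> /eqP; rewrite -subr_eq0 => /eqP eqF.
move=> /eqP; rewrite -subr_eq0 => /eqP eqG1.
move=> /eqP; rewrite -subr_eq0 => /eqP eqG2.
set e := _ - _ in eqF; set e1 := _ - _ in eqG1; set e2 := _ - _ in eqG2.
apply/eqP; rewrite -subr_eq0; apply/eqP.
(* The combination [(1 - t * y) * e1 + y * e2] is free of [G2], and its coefficient of [G1] is
   [1 - t * y - x ^+ 2 * F]; that of [e] is [- (y + x ^+ 2 * F)]. Cross-multiplying cancels [G1]. *)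
transitivity (- (e * (1 - t * y - x ^+ 2 * F))
    - (y + x ^+ 2 * F) * ((1 - t * y) * e1 + y * e2)).
  by rewrite /e /e1 /e2; ring.
by rewrite eqF eqG1 eqG2 !(mulr0, mul0r, addr0, oppr0).
Qed.

(** Completes the square in the quadratic satisfied by [F'], whose linear coefficient is
    [1 - 2 * B + C]. Inverses enter as elements [D'] and [F'], so that [ring] meets only
    polynomials. *)
Lemma discriminant (K : comNzRingType) (x z t F F' D' : K) :
  let y := x * z in
  let D := 1 - x * z * (t - 1) - x ^+ 2 * z ^+ 2 * (t - 1) in
  let A := x + x ^+ 3 * z ^+ 2 * (t - 1) * D' in
  let B := x * z + x ^+ 3 * z ^+ 3 * (t - 1) * D' in
  let C := x * z
           + x ^+ 3 * z ^+ 2 * (t - 1) * (z + x * (t - 1) + x ^+ 2 * (t - 1) * z) * D'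
           + x ^+ 3 * (t - 1) * z in
  D * D' = 1 -> F * F' = 1 ->
  x ^+ 2 * F ^+ 2 =
    (1 - t * y + x ^+ 2 * y * (t - 1)) * F - (1 - y * (t - 1) - y ^+ 2 * (t - 1)) ->
  (2 * F' - 2 * (1 - B) + 1 - C) ^+ 2 = (1 - C) ^+ 2 - 4 * A ^+ 2.
Proof.
move=> y D A B C DD FF quad.
have D0 : 1 - D * D' = 0 by rewrite DD subrr.
(* In each of these three identities the two sides differ by a multiple of [1 - D * D']. *)
have EB : B = 1 - (1 - t * y) * D'.
  by apply/eqP; rewrite -subr_eq0 -(mulr0 (y - 1)) -D0 /B /D /y; apply/eqP; ring.
have EA : A = x * (1 - y * (t - 1)) * D'.
  by apply/eqP; rewrite -subr_eq0 -(mulr0 x) -D0 /A /D /y; apply/eqP; ring.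
have EC : C = B + x ^+ 2 * y * (t - 1) * D'.
  apply/eqP; rewrite -subr_eq0 -(mulr0 (x ^+ 2 * y * (t - 1))) -D0 /C /B /D /y.
  by apply/eqP; ring.
have quad' : F' ^+ 2 =
    D' * ((1 - t * y + x ^+ 2 * y * (t - 1)) * F' - x ^+ 2).
  have : D' * F' ^+ 2 * (x ^+ 2 * F ^+ 2) = D' * F' ^+ 2
      * ((1 - t * y + x ^+ 2 * y * (t - 1)) * F - D).
    by rewrite quad /D /y; congr (_ * _); ring.
  have -> : D' * F' ^+ 2 * (x ^+ 2 * F ^+ 2) = D' * x ^+ 2 * (F * F') ^+ 2 by ring.
  have -> : D' * F' ^+ 2 * ((1 - t * y + x ^+ 2 * y * (t - 1)) * F - D) =
      D' * (1 - t * y + x ^+ 2 * y * (t - 1)) * F' * (F * F') - F' ^+ 2 * (D * D').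
    by ring.
  by rewrite FF DD expr1n !mulr1 => E; rewrite [RHS]mulrBr E; ring.
have -> : (2 * F' - 2 * (1 - B) + 1 - C) ^+ 2 = (1 - C) ^+ 2 - 4 * A ^+ 2
    + 4 * (F' ^+ 2 - D' * ((1 - t * y + x ^+ 2 * y * (t - 1)) * F' - x ^+ 2)
      - x ^+ 2 * D' * (1 - D * D')).
  by rewrite EC EB EA /D /y; ring.
by rewrite -quad' D0; ring.
Qed.

(** * Choice of the square root and the closed form *)

Lemma F123_gf : F123 = gf tvar zvar false false.
Proof.
apply: fpsP => n; rewrite /= /total /nclists big_map big_enum /=.
by apply: eq_bigr => s /weight_one_line ->.
Qed.

Lemma unit2_coefRing : (2 : coefRing) \is a GRing.unit.
Proof.
apply/unitrPr; exists (2^-1 : rat)%:MP.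
by rewrite -[2]/(2%:R : {mpoly rat[2]}) -mpolyC_nat -mpolyCM mulfV.
Qed.

Theorem theorem4p2 :
  let x : fps coefRing := fpsX coefRing in
  let t : fps coefRing := fpsC tvar in
  let z : fps coefRing := fpsC zvar in
  let D := 1 - x * z * (t - 1) - x ^+ 2 * z ^+ 2 * (t - 1) in
  let A := x + x ^+ 3 * z ^+ 2 * (t - 1) / D in
  let B := x * z + x ^+ 3 * z ^+ 3 * (t - 1) / D in
  let C := x * z
           + x ^+ 3 * z ^+ 2 * (t - 1) * (z + x * (t - 1) + x ^+ 2 * (t - 1) * z) / D
           + x ^+ 3 * (t - 1) * z in
  tofrac F123 =
    tofrac (2 * A ^+ 2) /
    tofrac (2 * (1 - B) * A ^+ 2 - A ^+ 2 + A ^+ 2 * C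
            + A ^+ 2 * fps_sqrt ((1 - C) ^+ 2 - 4 * A ^+ 2)).
Proof.
move=> x t z D A B C.
have c0x (f : fps coefRing) : coefs (x * f) 0 = 0 by rewrite coefsXM.
have D1 : coefs D 0 = 1.
  by rewrite /D expr2 -!mulrA !coefsD !coefsN !c0x coefs1 oppr0 !addr0.
have uD : D \is a GRing.unit by rewrite -[_ \is a _]/(fps_unit D) /fps_unit D1 unitr1.
have B0 : coefs B 0 = 0.
  by rewrite /B exprS -!mulrA coefsD !c0x addr0.
have C0 : coefs C 0 = 0.
  by rewrite /C !exprS -!mulrA !coefsD !c0x !addr0.
have F1 : coefs F123 0 = 1 by rewrite F123_gf; exact: total0.
have uF : F123 \is a GRing.unit.
  by rewrite -[_ \is a _]/(fps_unit F123) /fps_unit F1 unitr1.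
have quad := quadratic_of_system (x := x) (y := x * z) (t := t)
  (F := F123) (G1 := gf tvar zvar true false) (G2 := gf tvar zvar true true).
have {}quad : x ^+ 2 * F123 ^+ 2 = (1 - t * (x * z) + x ^+ 2 * (x * z) * (t - 1)) * F123
    - (1 - (x * z) * (t - 1) - (x * z) ^+ 2 * (t - 1)).
  apply: quad; rewrite ?F123_gf [LHS]gf_eq ?mul1r ?addrA //.
have disc := discriminant (divrr uD) (divrr uF) quad.
(* By [disc] the left side squares to the radicand; its constant term is 2 - 2 + 1 = 1, which
   selects the root. *)
have sqrtE : 2 * F123^-1 - 2 * (1 - B) + 1 - C = fps_sqrt ((1 - C) ^+ 2 - 4 * A ^+ 2).
  apply: fps_sqrt_uniq; [exact: unit2_coefRing| |exact: disc].
  have F'1 : coefs F123^-1 0 = 1.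
    have := congr1 (fun f => coefs f 0) (divrr uF).
    by rewrite coefsM big_ord1 subn0 F1 mul1r coefs1.
  move: (B) (C) B0 C0 => b c b0 c0.
  rewrite !coefsD !coefsN !coefsM !big_ord1 !subn0 !coefsD !coefsN F'1 b0 c0 coefs1.
  by rewrite !subr0 mulr1 subrr add0r.
rewrite -sqrtE.
have -> : 2 * (1 - B) * A ^+ 2 - A ^+ 2 + A ^+ 2 * C
    + A ^+ 2 * (2 * F123^-1 - 2 * (1 - B) + 1 - C) = 2 * A ^+ 2 * F123^-1 by ring.
(* The denominator has become [2 * A ^+ 2 * F123^-1]. Its constant term is 0, so it is no unit among
   power series, but being nonzero it cancels in the fraction field. The coefficient of x in [A] is
   1. *)
have nzA : A != 0.
  apply/eqP => /(congr1 (fun f => coefs f 1)).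
  rewrite /A coefsD !exprS -!mulrA !coefsXM addr0 => /eqP.
  by rewrite oner_eq0.
have nz2 : (2 : fps coefRing) != 0.
  apply/eqP => /(congr1 (fun f => coefs f 0)) E.
  by have := unit2_coefRing; rewrite [2](E : 2 = 0) unitr0.
have nz : tofrac (2 * A ^+ 2 * F123^-1) != 0.
  rewrite tofrac_eq0 !mulf_neq0 ?expf_neq0 //.
  by apply: contraTneq uF => E; rewrite -unitrV E unitr0.
apply: (canRL (mulfK nz)); rewrite -tofracM; congr tofrac.
by rewrite mulrC divrK.
Qed.
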